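(* Let $n\geq l\geq 3$ be integers. If $G$ is an $n$-vertex unicyclic graph with girth $l$, then $$n(US_n^l)\geq n(G)\geq n(UP_n^l).$$
   Context: A unicyclic graph is a connected graph containing exactly one cycle; its girth is the length of that cycle. A subtree of a graph $G$ is a subgraph of $G$ that is a tree (subtrees are distinguished as subgraphs); $n(G)$ is the number of subtrees of $G$, counting also the empty subtree. $US_n^l$ is the graph obtained from the cycle $C_l$ by attaching $n-l$ pendent vertices to one vertex of the cycle. $UP_n^l$ is the graph obtained from $C_l$ by attaching a pendent path of length $n-l$ to one vertex of the cycle (i.e. identifying a cycle vertex with an end vertex of a path with $n-l$ edges whose other vertices are new). *)

(* Defs.v *)
From mathcomp Require Import all_boot.
Set Implicit Arguments. Unset Strict Implicit. Unset Printing Implicit Defensive.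

Section Graphs.
Variable n : nat.
Implicit Types (G : rel 'I_n) (S : {set 'I_n}) (F : {set {set 'I_n}}).

Definition simple_graph G := symmetric G /\ irreflexive G.

Definition edges G : {set {set 'I_n}} :=
  [set e | [exists x, exists y, G x y && (e == [set x; y])]].

Definition adjF F : rel 'I_n := fun u v => [set u; v] \in F.

Definition is_subgraph G S F :=
  (F \subset edges G) && [forall e in F, e \subset S].

Definition sub_connected S F :=
  [forall x in S, forall y in S, connect (adjF F) x y].

Definition is_subtree G (p : {set 'I_n} * {set {set 'I_n}}) :=
  [&& is_subgraph G p.1 p.2, p.1 != set0,
      #|p.2|.+1 == #|p.1| & sub_connected p.1 p.2].

(* number of subtrees, counting also the empty subtree *)
Definition nsubtrees G : nat := #|[set p | is_subtree G p]|.+1.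

Definition degF F v := #|[set e in F | v \in e]|.

Definition is_cycle G (p : {set 'I_n} * {set {set 'I_n}}) :=
  [&& is_subgraph G p.1 p.2, 3 <= #|p.1|,
      [forall v in p.1, degF p.2 v == 2] & sub_connected p.1 p.2].

Definition connected_graph G := forall x y : 'I_n, connect G x y.

Definition unicyclic_girth G l :=
  [/\ connected_graph G, #|[set p | is_cycle G p]| = 1 &
      forall p, is_cycle G p -> #|p.1| = l].

End Graphs.

Definition symr (T : Type) (b : T -> T -> bool) : rel T := fun x y => b x y || b y x.

(* US_n^l: cycle 0-1-...-(l-1)-0, plus pendent vertices l..n-1 attached to 0 *)
Definition US (n l : nat) : rel 'I_n :=
  symr (fun x y : 'I_n =>
          ((val y == (val x).+1) && (val y < l))
       || ((val x == 0) && ((val y == l.-1) || (l <= val y)))).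

(* UP_n^l: path 0-1-...-(n-1) plus edge {0, l-1}; i.e. cycle 0..l-1 with the
   pendent path (l-1)-l-...-(n-1) of length n-l attached at vertex l-1 *)
Definition UP (n l : nat) : rel 'I_n :=
  symr (fun x y : 'I_n =>
          (val y == (val x).+1) || ((val x == 0) && (val y == l.-1))).

Arguments US n l : clear implicits.
Arguments UP n l : clear implicits.

(* Main.v *)
(* Every unicyclic graph G grows from its cycle, an induced C_l, by adding vertices v
   that have exactly one neighbour w in the current vertex set S: a second one would
   close another cycle.  Let N(S) and N_u(S) count the nonempty subtrees inside S and
   those among them containing u.  Then N_v(S+v) = 1 + N_w(S),
   N(S+v) = N(S) + 1 + N_w(S), and N_u(S) + 1 <= N_u(S+v) <= 2 N_u(S) for u in S, with
   equality on the right for u = w.  If a is the common value of N_u on C_l, then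
   a + k <= N_u(S) <= a 2^k once k vertices have been added.  In UP the new vertex
   always has the lower bound at its neighbour, in US the upper bound. *)

Require Import Defs.
From mathcomp Require Import all_boot zify.
Set Implicit Arguments. Unset Strict Implicit. Unset Printing Implicit Defensive.

(** * Subtrees inside a vertex set, counted with or without a prescribed vertex *)

Section Subtrees.
Variable n : nat.
Implicit Types (G H : rel 'I_n) (S : {set 'I_n}) (F : {set {set 'I_n}}).
Implicit Types (u v w x y : 'I_n) (c d : seq 'I_n).
Implicit Types p : {set 'I_n} * {set {set 'I_n}}.

(** The cardinals of this set and of the next one are N(S) and N_u(S); the empty subtree is left out
    of both. *)
Definition subtrees_in G S := [set p | is_subtree G p && (p.1 \subset S)].

Definition subtrees_at G S u := [set p in subtrees_in G S | u \in p.1].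

Lemma nsubtreesE G : nsubtrees G = #|subtrees_in G setT|.+1.
Proof.
by congr _.+1; apply: eq_card => p; rewrite !inE subsetT andbT.
Qed.

Lemma adjF_sym F : symmetric (adjF F).
Proof. by move=> x y; rewrite /adjF setUC. Qed.

Lemma mem_edges G x y : symmetric G -> ([set x; y] \in edges G) = G x y.
Proof.
move=> symG; rewrite inE; apply/existsP/idP => [[a /existsP[b]]|Gxy]; last first.
  by exists x; apply/existsP; exists y; rewrite Gxy eqxx.
case/andP=> Gab /eqP eqE.
have: x \in [set a; b] by rewrite -eqE set21.
have: y \in [set a; b] by rewrite -eqE set22.
have: a \in [set x; y] by rewrite eqE set21.
have: b \in [set x; y] by rewrite eqE set22.
rewrite !inE.
case/orP=> /eqP eb; case/orP=> /eqP ea; subst a b; rewrite ?orbb => yab xab //.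
- by rewrite (eqP yab).
- by rewrite symG.
- by rewrite (eqP xab).
Qed.

Lemma edgesE G (e : {set 'I_n}) :
  e \in edges G -> exists x, exists2 y, G x y & e = [set x; y].
Proof.
rewrite inE => /existsP[x /existsP[y /andP[Gxy /eqP->]]].
by exists x, y.
Qed.

Lemma subgraph_adj G S F x y : symmetric G ->
  is_subgraph G S F -> adjF F x y -> [/\ G x y, x \in S & y \in S].
Proof.
move=> symG /andP[FG /forall_inP FS] Fxy.
have /subsetP sS := FS _ Fxy.
by split; [rewrite -mem_edges // (subsetP FG) | apply: sS; rewrite set21 |
  apply: sS; rewrite set22].
Qed.

Lemma is_subgraphS G S (S' : {set 'I_n}) F :
  S \subset S' -> is_subgraph G S F -> is_subgraph G S' F.
Proof.
move=> SS' /andP[FG /forall_inP FS]; apply/andP; split=> //.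
by apply/forall_inP => e /FS eX; apply: subset_trans SS'.
Qed.

(** An edge may go to any path, even a trivial one, so this covers retractions that collapse an edge
    as well as injective maps. *)
Lemma connect_homo (T T' : finType) (e : rel T) (e' : rel T') (r : T -> T') :
  (forall a b, e a b -> connect e' (r a) (r b)) ->
  forall a b, connect e a b -> connect e' (r a) (r b).
Proof.
move=> hr a b /connectP[s]; elim: s a => [|c s IHs] a /=; first by move=> _ ->.
case/andP=> /hr eac /IHs{}IHs /IHs; exact: connect_trans.
Qed.

Lemma subtree1 G v : is_subtree G ([set v], set0).
Proof.
apply/and4P; split=> /=.
- by rewrite /is_subgraph sub0set /=; apply/forall_inP => e; rewrite inE.
- by apply/set0Pn; exists v; rewrite inE.
- by rewrite cards0 cards1.
- apply/forall_inP => x /set1P->; apply/forall_inP => y /set1P->.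
  exact: connect0.
Qed.

(** * Attaching a pendent vertex and its effect on the counts *)

Definition add_leaf v w p := (v |: p.1, [set v; w] |: p.2).

Lemma add_leaf_fresh G v w p : is_subtree G p -> v \notin p.1 ->
  [set v; w] \notin p.2.
Proof.
case/and4P=> /andP[_ /forall_inP FS] _ _ _; apply: contra => /FS/subsetP; apply.
exact: set21.
Qed.

Lemma add_leaf_subtree G v w p : is_subtree G p -> v \notin p.1 ->
  w \in p.1 -> symmetric G -> G v w -> is_subtree G (add_leaf v w p).
Proof.
move=> pT vp wp symG Gvw; have vwF := add_leaf_fresh w pT vp.
case/and4P: pT => /andP[FG /forall_inP FS] p0 cp /forall_inP conn.
apply/and4P; split=> /=.
- apply/andP; split.
    by rewrite subUset FG sub1set mem_edges // Gvw.
  apply/forall_inP => e; rewrite in_setU1 => /predU1P[->|/FS eS].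
    by rewrite subUset !sub1set setU11 in_setU1 wp orbT.
  by rewrite (subset_trans eS) ?subsetUr.
- by apply/set0Pn; exists v; rewrite setU11.
- by rewrite !cardsU1 vp vwF !add1n (eqP cp).
- pose e' := adjF ([set v; w] |: p.2).
  have sub x y : connect (adjF p.2) x y -> connect e' x y.
    apply: connect_sub => a b ab; apply: connect1.
    by rewrite /e' /adjF in_setU1 -/(adjF p.2 a b) ab orbT.
  (* It is enough to join every vertex to [w]; symmetry then joins any two. *)
  have toW x : x \in v |: p.1 -> connect e' x w.
    rewrite in_setU1 => /predU1P[->|xp].
      by apply: connect1; rewrite /e' /adjF setU11.
    by apply: sub; apply: (forall_inP (conn _ xp)).
  apply/forall_inP => x /toW xw; apply/forall_inP => y /toW yw.
  apply: connect_trans xw _.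
  by rewrite (sym_connect_sym (@adjF_sym _)).
Qed.

(** Only the neighbours inside [S] are restricted: [v] may have others outside, which join later. *)
Definition pendent G S v w :=
  [/\ v \notin S, w \in S, G v w & forall x, x \in S -> G v x -> x = w].

Section Pendent.
Variables (G : rel 'I_n) (S : {set 'I_n}) (v w : 'I_n).
Hypotheses (symG : symmetric G) (irrG : irreflexive G).
Hypothesis vPw : pendent G S v w.

Lemma pendent_adj F x : is_subgraph G (v |: S) F -> adjF F v x -> x = w.
Proof.
case: vPw => vS wS Gvw uniq_w sg /(subgraph_adj symG sg)[Gvx _].
rewrite in_setU1 => /predU1P[xv|xS]; last exact: uniq_w.
by rewrite xv irrG in Gvx.
Qed.

(** The only edge available at [v] is [[set v; w]], so a larger tree through [v] must use it.
    Deleting both lowers the numbers of vertices and edges by one each, and connectedness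
    survives. *)
Lemma remove_leaf p : is_subtree G p -> p.1 \subset v |: S -> v \in p.1 ->
  p != ([set v], set0) ->
  exists2 q, q \in subtrees_at G S w & p = add_leaf v w q.
Proof.
move=> pT pS vp pn1; have := pT.
case/and4P=> sg p0 cp /forall_inP conn.
have sg' := is_subgraphS pS sg.
have vw : v != w by case: vPw => vS wS _ _; apply: contraNneq vS => ->.
(* If [v] were the only vertex, the edge count would leave no edge, and [p] would be the excluded
   one-vertex tree. *)
have [x xp xv] : exists2 x, x \in p.1 & x != v.
  have [D0|/set0Pn[x]] := eqVneq (p.1 :\ v) set0; last first.
    by rewrite !inE => /andP[xv xp]; exists x.
  case/eqP: pn1; have e1 : p.1 = [set v] by rewrite -(setD1K vp) D0 setU0.
  move: cp; rewrite e1 cards1 eqSS cards_eq0 => /eqP e2.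
  by rewrite [p]surjective_pairing e1 e2.
(* A path from [v] to [x] starts with an edge at [v]. *)
have vwF : [set v; w] \in p.2.
  have /connectP[[|y s] /=] := forall_inP (conn _ vp) _ xp.
    by move=> _ xE; rewrite xE eqxx in xv.
  by case/andP=> vy _ _; move: (vy); rewrite (pendent_adj sg' vy).
have wp : w \in p.1 by case: (subgraph_adj symG sg vwF).
pose q := (p.1 :\ v, p.2 :\ [set v; w]).
have pE : p = add_leaf v w q.
  by rewrite /add_leaf /q /= !setD1K // -surjective_pairing.
exists q; last exact: pE; clear pE; rewrite !inE /= eq_sym vw wp subDset pS !andbT.
apply/and4P; split=> /=.
- case/andP: sg => FG /forall_inP FS; apply/andP; split.
    by apply: subset_trans FG; apply: subD1set.
  apply/forall_inP => e /setD1P[evw eF]; apply/subsetD1P; split; first exact: FS.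
  apply: contra evw => ve.
  have [a [b Gab eE]] := edgesE (subsetP FG _ eF); subst e.
  move: ve; rewrite !inE => /orP[]/eqP va; rewrite -va in eF *.
    by rewrite (pendent_adj sg' eF).
  by rewrite setUC in eF *; rewrite (pendent_adj sg' eF).
- by apply/set0Pn; exists w; rewrite !inE eq_sym vw.
- by move: cp; rewrite (cardsD1 v) vp (cardsD1 [set v; w] p.2) vwF !add1n eqSS.
- apply/forall_inP => a /setD1P[av ap]; apply/forall_inP => b /setD1P[bv bp].
  (* the retraction sending v to w maps every edge of p to an edge of q or to a point *)
  pose r z := if z == v then w else z.
  suff : connect (adjF q.2) (r a) (r b) by rewrite /r (negPf av) (negPf bv).
  apply: (connect_homo (e := adjF p.2)); last exact: (forall_inP (conn _ ap)).
  move=> i j ij; rewrite /r.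
  have [iv|iv] := eqVneq i v; have [jv|jv] := eqVneq j v.
  + exact: connect0.
  + by rewrite iv in ij; rewrite (pendent_adj sg' ij) connect0.
  + by rewrite jv adjF_sym in ij; rewrite (pendent_adj sg' ij) connect0.
  + apply: connect1; rewrite /adjF !inE -/(adjF p.2 i j) ij andbT.
    apply/eqP => E; have : v \in [set i; j] by rewrite E set21.
    by rewrite !inE ![v == _]eq_sym (negPf iv) (negPf jv).
Qed.

(** Both [v] and the edge [[set v; w]] are new to a subtree inside [S], so deleting them recovers
    it. *)
Lemma add_leaf_inj : {in subtrees_in G S &, injective (add_leaf v w)}.
Proof.
case: vPw => vS _ _ _ [X F] [Y F']; rewrite !inE /= => /andP[XT XS] /andP[YT YS].
have vX : v \notin X by apply: contra vS; apply: subsetP.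
have vY : v \notin Y by apply: contra vS; apply: subsetP.
case=> EX EF; congr pair.
  by rewrite -(setU1K vX) -(setU1K vY) EX.
have /= <- := setU1K (add_leaf_fresh w XT vX).
by have /= <- := setU1K (add_leaf_fresh w YT vY); rewrite EF.
Qed.

Lemma subtrees_at_leaf : subtrees_at G (v |: S) v =
  ([set v], set0) |: [set add_leaf v w q | q in subtrees_at G S w].
Proof.
case: (vPw) => vS wS Gvw _.
apply/setP => p; rewrite in_setU1 [in LHS]inE [p \in _]inE -andbA.
apply/and3P/predU1P => [[pT pS vp]|].
  have [->|pn1] := eqVneq p ([set v], set0); [by left|right].
  by have [q qT ->] := remove_leaf pT pS vp pn1; apply: imset_f.
case=> [->|/imsetP[q]].
  by split=> /=; [exact: subtree1 | rewrite sub1set setU11 | rewrite inE].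
rewrite !inE -andbA => /and3P[qT qS wq] ->; split=> /=.
- apply: add_leaf_subtree => //.
  by apply: contra vS; apply: subsetP.
- exact: setUS.
- exact: setU11.
Qed.

Lemma leaf_notin : ([set v], set0) \notin [set add_leaf v w q | q in subtrees_at G S w].
Proof.
apply/negP => /imsetP[q _ [_ /setP/(_ [set v; w])]].
by rewrite setU11 inE.
Qed.

Lemma card_subtrees_at_leaf :
  #|subtrees_at G (v |: S) v| = #|subtrees_at G S w|.+1.
Proof.
rewrite subtrees_at_leaf cardsU1 leaf_notin card_in_imset //.
by move=> p q /setIdP[pS _] /setIdP[qS _]; apply: add_leaf_inj.
Qed.

Lemma subtrees_notin p : v \notin p.1 ->
  (p \in subtrees_in G (v |: S)) = (p \in subtrees_in G S).
Proof.
case: vPw => vS _ _ _ vp; rewrite !inE; congr andb.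
apply/idP/idP => [/subsetP sp|sp]; last by rewrite (subset_trans sp) ?subsetUr.
apply/subsetP => x xp; have := sp x xp.
by rewrite in_setU1 => /predU1P[xv|//]; rewrite -xv xp in vp.
Qed.

Lemma subtrees_in_notin p : p \in subtrees_in G S -> v \notin p.1.
Proof.
case: vPw => vS _ _ _; rewrite inE => /andP[_ /subsetP pS].
by apply: contra vS; apply: pS.
Qed.

(** Split by whether the subtree contains [v]: those avoiding it lie in [S], the others are counted
    by [card_subtrees_at_leaf]. *)
Lemma card_subtrees_leaf :
  #|subtrees_in G (v |: S)| = #|subtrees_in G S| + #|subtrees_at G S w|.+1.
Proof.
rewrite -card_subtrees_at_leaf.
rewrite -(cardsID [set p : {set 'I_n} * {set {set 'I_n}} | v \in p.1]) addnC.
congr addn.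
  apply: eq_card => p; rewrite !inE andbC.
  have [vp|vp] := boolP (v \in p.1) => /=; last first.
    by have := subtrees_notin vp; rewrite !inE andbT.
  rewrite andbF; apply/esym/negbTE/negP => pT.
  by have := @subtrees_in_notin p; rewrite inE vp => /(_ pT).
by apply: eq_card => p; rewrite !inE.
Qed.

(** A subtree through both [u] and [v] becomes, without [v], a subtree in [S] through both [u] and
    [w]. The next three lemmas estimate this last term: at most N_u(S), equal to it for [u = w], and
    positive if [S] has a spanning subtree. *)
Lemma card_subtrees_at_old u : u \in S -> #|subtrees_at G (v |: S) u| =
  #|subtrees_at G S u| + #|[set p in subtrees_at G S w | u \in p.1]|.
Proof.
move=> uS; case: (vPw) => vS _ _ _.
have uv : u != v by apply: contraNneq vS => <-.
rewrite -(cardsID [set p : {set 'I_n} * {set {set 'I_n}} | v \in p.1]) addnC.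
congr addn.
  apply: eq_card => p; rewrite !inE andbC.
  have [vp|vp] := boolP (v \in p.1) => /=; last first.
    by have := subtrees_notin vp; rewrite !inE => ->; rewrite andbT.
  rewrite andbF; apply/esym/negbTE/negP => /andP[pT _].
  by have := @subtrees_in_notin p; rewrite inE vp => /(_ pT).
rewrite -[RHS](card_in_imset (f := add_leaf v w)); last first.
  by move=> p q /setIdP[/setIdP[pS _] _] /setIdP[/setIdP[qS _] _]; apply: add_leaf_inj.
apply: eq_card => p; apply/idP/idP.
  rewrite in_setI => /andP[/setIdP[pT up]]; rewrite inE => vp.
  have : p \in subtrees_at G (v |: S) v by rewrite inE pT.
  rewrite subtrees_at_leaf => /setU1P[pE|/imsetP[q qT pE]].
    by move: up; rewrite pE inE (negPf uv).
  apply/imsetP; exists q => //; rewrite inE qT.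
  by move: up; rewrite pE in_setU1 (negPf uv).
case/imsetP=> q /setIdP[qT uq] pE.
have : p \in subtrees_at G (v |: S) v.
  by rewrite subtrees_at_leaf pE; apply/setU1r/imset_f.
case/setIdP=> pT vp; rewrite in_setI; apply/andP; split; last by rewrite inE.
by apply/setIdP; rewrite {2}pE in_setU1 uq orbT.
Qed.

Lemma card_subtrees_at_leaf_le u : u \in S ->
  #|subtrees_at G (v |: S) u| <= #|subtrees_at G S u|.*2.
Proof.
move=> uS; rewrite card_subtrees_at_old // -addnn leq_add2l subset_leq_card //.
by apply/subsetP => p /setIdP[/setIdP[pS _] up]; apply/setIdP.
Qed.

Lemma card_subtrees_at_support :
  #|subtrees_at G (v |: S) w| = #|subtrees_at G S w|.*2.
Proof.
case: (vPw) => _ wS _ _; rewrite card_subtrees_at_old // -addnn; congr addn.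
by apply: eq_card => p; rewrite !inE -andbA andbb.
Qed.

Lemma card_subtrees_at_leaf_gt u p : u \in S -> is_subtree G p -> p.1 = S ->
  #|subtrees_at G S u| < #|subtrees_at G (v |: S) u|.
Proof.
case: (vPw) => _ wS _ _ uS pT pE.
rewrite card_subtrees_at_old // -[X in X < _]addn0 ltn_add2l.
by apply/card_gt0P; exists p; rewrite !inE pT pE subxx wS uS.
Qed.

End Pendent.

End Subtrees.

(** * Transport of subtrees, and cycles given as lists of vertices *)

Section Cycles.
Variable n : nat.
Implicit Types (G H : rel 'I_n) (S : {set 'I_n}) (F : {set {set 'I_n}}).
Implicit Types (u v w x y : 'I_n) (c d : seq 'I_n).
Implicit Types p : {set 'I_n} * {set {set 'I_n}}.

(** Lifts injectivity from points to sets; a second application, over [powerset S], lifts it to sets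
    of edges. *)
Lemma imset_inj_in (T T' : finType) (f : T -> T') (S A B : {set T}) :
  {in S &, injective f} -> A \subset S -> B \subset S ->
  f @: A = f @: B -> A = B.
Proof.
move=> injf.
suff sub (X Y : {set T}) : X \subset S -> Y \subset S -> f @: X = f @: Y -> X \subset Y.
  by move=> AS BS E; apply/eqP; rewrite eqEsubset (sub A B) ?(sub B A).
move=> /subsetP XS /subsetP YS E; apply/subsetP => x xX.
have /imsetP[y yY fxy] : f x \in f @: Y by rewrite -E imset_f.
by rewrite (injf _ _ (XS _ xX) (YS _ yY) fxy).
Qed.

Lemma imset_set2 (T T' : finType) (f : T -> T') (x y : T) :
  f @: [set x; y] = [set f x; f y].
Proof. by rewrite imsetU1 imset_set1. Qed.

Section Transport.
Variables (G H : rel 'I_n) (S : {set 'I_n}) (f : 'I_n -> 'I_n).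
Hypothesis symG : symmetric G.
Hypothesis injf : {in S &, injective f}.
Hypothesis homf : {in S &, forall x y, H x y -> G (f x) (f y)}.

Definition image_subgraph p := (f @: p.1, [set f @: (e : {set 'I_n}) | e in p.2]).

Lemma subtree_edges p (e : {set 'I_n}) :
  p \in subtrees_in H S -> e \in p.2 -> e \subset S.
Proof.
rewrite inE => /andP[/and4P[/andP[_ /forall_inP pF] _ _ _] pS] /pF eS.
exact: subset_trans eS pS.
Qed.

Lemma image_subtree p : p \in subtrees_in H S ->
  image_subgraph p \in subtrees_in G (f @: S).
Proof.
move=> pT; have eS := subtree_edges pT; move: pT; rewrite !inE.
case/andP=> /and4P[/andP[/subsetP FG /forall_inP FS] p0 cp /forall_inP conn] pS.
rewrite (imsetS _ pS) andbT; apply/and4P; split=> /=.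
- apply/andP; split; last first.
    by apply/forall_inP => _ /imsetP[e /FS eP ->]; apply: imsetS.
  apply/subsetP => _ /imsetP[e eF ->].
  have [x [y Hxy eE]] := edgesE (FG _ eF); have /subsetP := eS _ eF; rewrite eE => sS.
  by rewrite imset_set2 mem_edges // homf // sS ?set21 ?set22.
- by case/set0Pn: p0 => x xp; apply/set0Pn; exists (f x); apply: imset_f.
- rewrite !card_in_imset //.
    by move=> x y xp yp; apply: injf; apply: (subsetP pS).
  by move=> e e' /eS eP /eS eP'; apply: imset_inj_in eP eP'.
- apply/forall_inP => _ /imsetP[x xp ->]; apply/forall_inP => _ /imsetP[y yp ->].
  apply: (connect_homo (e := adjF p.2) (r := f)); last exact: (forall_inP (conn _ xp)).
  by move=> a b ab; apply: connect1; rewrite /adjF /= -imset_set2; apply: imset_f.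
Qed.

Lemma image_subgraph_inj : {in subtrees_in H S &, injective image_subgraph}.
Proof.
move=> p q pT qT [E1 E2]; rewrite [p]surjective_pairing [q]surjective_pairing.
congr pair.
  by apply: (imset_inj_in injf) E1; [case/setIdP: pT | case/setIdP: qT].
apply: (imset_inj_in (f := fun e : {set 'I_n} => f @: e) (S := powerset S)) E2.
- by move=> e e'; rewrite !inE; apply: imset_inj_in.
- by apply/subsetP => e; rewrite inE; apply: subtree_edges.
- by apply/subsetP => e; rewrite inE; apply: subtree_edges.
Qed.

(** Adjacency is preserved in one direction only, hence an inequality; equality for cycles comes
    from exchanging the two graphs. *)
Lemma card_subtrees_in_image : #|subtrees_in H S| <= #|subtrees_in G (f @: S)|.
Proof.
rewrite -(card_in_imset image_subgraph_inj) subset_leq_card //.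
by apply/subsetP => _ /imsetP[p pT ->]; apply: image_subtree.
Qed.

Lemma card_subtrees_at_image u :
  #|subtrees_at H S u| <= #|subtrees_at G (f @: S) (f u)|.
Proof.
rewrite -(card_in_imset (f := image_subgraph)).
  apply/subset_leq_card/subsetP => _ /imsetP[p /setIdP[pT up] ->].
  by rewrite inE image_subtree // imset_f.
by move=> p q /setIdP[pT _] /setIdP[qT _]; apply: image_subgraph_inj.
Qed.

End Transport.

(** The equality excludes chords, so that the subtrees inside [c] depend only on its length. *)
Definition induced_cycle G c :=
  uniq c /\ {in c &, forall x y, G x y = (y == next c x) || (x == next c y)}.

Lemma induced_cycle_rot G c i : induced_cycle G c -> induced_cycle G (rot i c).
Proof.
case=> Uc Gc; split=> [|x y]; first by rewrite rot_uniq.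
by rewrite !mem_rot !next_rot //; apply: Gc.
Qed.

(** Turns [next] into arithmetic on positions with wrap-around, so that two cycles can be matched
    position by position. *)
Lemma next_index (T : eqType) (x0 x : T) (c : seq T) : x \in c ->
  next c x = nth x0 c (if (index x c).+1 < size c then (index x c).+1 else 0).
Proof.
case: c => // y c xc; rewrite next_nth xc.
case: ltnP => [lt|ge]; last by rewrite nth_default //=.
by rewrite /= (set_nth_default x0).
Qed.

(** Rotate the lists so that [x] and [y] come first. Matching equal positions commutes with [next],
    hence is an injective homomorphism sending [x] to [y]. *)
Lemma induced_cycle_le G H c d x y : symmetric G ->
  induced_cycle H c -> induced_cycle G d -> size c = size d ->
  x \in c -> y \in d ->
  #|subtrees_in H [set z in c]| <= #|subtrees_in G [set z in d]| /\
  #|subtrees_at H [set z in c] x| <= #|subtrees_at G [set z in d] y|.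
Proof.
move=> symG + + + xc yd.
have [i c' cE] := rot_to xc; have [j d' dE] := rot_to yd.
have -> : [set z in c] = [set z in x :: c'].
  by apply/setP => z; rewrite -cE !inE mem_rot.
have -> : [set z in d] = [set z in y :: d'].
  by apply/setP => z; rewrite -dE !inE mem_rot.
rewrite -(size_rot i c) -(size_rot j d).
move=> /(induced_cycle_rot i) + /(induced_cycle_rot j); rewrite cE dE.
set c1 := x :: c'; set d1 := y :: d' => -[Uc Hc] [Ud Gd] ecd.
pose f z := nth y d1 (index z c1).
have fd z : z \in c1 -> f z \in d1 by move=> zc; rewrite mem_nth // -ecd index_mem.
have injf : {in c1 &, injective f}.
  move=> a b ac bc /eqP; rewrite nth_uniq -?ecd ?index_mem // => /eqP E.
  by rewrite -(nth_index x ac) E nth_index.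
have fnext z : z \in c1 -> f (next c1 z) = next d1 (f z).
  move=> zc; rewrite (next_index y (fd _ zc)) (next_index x zc) /f.
  rewrite !index_uniq -?ecd ?index_mem //.
  by case: ifP.
have fS : f @: [set z in c1] = [set z in d1].
  apply/setP => z; rewrite !inE -/d1; apply/imsetP/idP => [[a]|zd].
    by rewrite inE => /fd fa ->.
  have iz : index z d1 < size c1 by rewrite ecd index_mem.
  exists (nth x c1 (index z d1)); first by rewrite inE mem_nth.
  by rewrite /f index_uniq // nth_index.
have fx : f x = y by rewrite /f /= eqxx.
have inj : {in [set z in c1] &, injective f}.
  by move=> a b; rewrite !inE; apply: injf.
have hom : {in [set z in c1] &, forall a b, H a b -> G (f a) (f b)}.
  move=> a b; rewrite !inE => ac bc; rewrite Hc // Gd ?fd //.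
  by case/orP=> /eqP-> //; rewrite fnext ?eqxx ?orbT.
rewrite -fS -[in X in _ /\ _ <= X]fx; split; first exact: card_subtrees_in_image.
exact: card_subtrees_at_image.
Qed.

Lemma induced_cycle_eq G H c d x y : symmetric G -> symmetric H ->
  induced_cycle H c -> induced_cycle G d -> size c = size d ->
  x \in c -> y \in d ->
  #|subtrees_in H [set z in c]| = #|subtrees_in G [set z in d]| /\
  #|subtrees_at H [set z in c] x| = #|subtrees_at G [set z in d] y|.
Proof.
move=> symG symH Hc Gd cd xc yd.
have [i1 a1] := induced_cycle_le symG Hc Gd cd xc yd.
have [i2 a2] := induced_cycle_le symH Gd Hc (esym cd) yd xc.
by split; apply/eqP; rewrite eqn_leq ?i1 ?i2 ?a1 ?a2.
Qed.

(** * Producing cycles, and passing between cycle lists and cycle subgraphs *)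

Lemma path_spanned G v s : symmetric G -> path G v s -> uniq (v :: s) ->
  exists2 p, is_subtree G p & p.1 = [set z in v :: s].
Proof.
move=> symG; elim: s v => [|w s IHs] v /=.
  by move=> _ _; exists ([set v], set0); [exact: subtree1 | apply/setP => z; rewrite !inE].
case/andP=> Gvw ps /andP[vs us]; have [p pT pE] := IHs w ps us.
exists (add_leaf v w p); last by apply/setP => z; rewrite /= pE !inE.
by apply: add_leaf_subtree => //; rewrite pE !inE ?eqxx //; rewrite inE in vs.
Qed.

(** A vertex lies on the edges to its successor and its predecessor only, and these edges differ
    because the length is at least three. *)
Lemma cycle_is_cycle G c : symmetric G -> irreflexive G ->
  uniq c -> 2 < size c -> cycle G c ->
  is_cycle G ([set z in c], [set [set z; next c z] | z in c]).
Proof.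
move=> symG irrG Uc c3 Gc; set S := [set z in c]; set F := [set _ | _ in _].
have szS : #|S| = size c by rewrite cardsE (card_uniqP Uc).
have Fnext x : x \in c -> adjF F x (next c x) by move=> xc; apply: imset_f.
have conn : sub_connected S F.
  apply/forall_inP => x; rewrite inE => xc; apply/forall_inP => y; rewrite inE => yc.
  by apply: (connect_cycle (p := c)) => //; apply: cycle_from_next.
apply/and4P; split=> //=.
- apply/andP; split.
    apply/subsetP => _ /imsetP[x xc ->]; rewrite mem_edges //.
    exact: next_cycle.
  apply/forall_inP => _ /imsetP[x xc ->].
  by rewrite subUset !sub1set !inE mem_next xc.
- by rewrite szS.
apply/forall_inP => v; rewrite inE => vc; rewrite /degF.
have -> : [set e in F | v \in e] = [set [set v; next c v]; [set prev c v; v]].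
  apply/setP => e; rewrite in_set2 inE; apply/andP/orP => [[]|].
    case/imsetP=> x xc ->; rewrite !inE => /orP[]/eqP ->; first by left.
    by right; rewrite prev_next.
  case=> /eqP->; rewrite ?set21 ?set22; split=> //; first exact: Fnext.
  by apply/imsetP; exists (prev c v); rewrite ?mem_prev ?next_prev.
rewrite cards2; suff -> : [set v; next c v] != [set prev c v; v] by [].
(* Were the two edges equal, [next c v] would be [v] or [prev c v]; in the latter case two steps
   along the cycle would return to [v]. *)
suff [n1 n2] : next c v != v /\ next c (next c v) != v.
  apply/eqP => /setP/(_ (next c v)); rewrite !inE eqxx orbT (negPf n1) orbF.
  by move/esym/eqP=> E; rewrite E next_prev // eqxx in n2.
have [i s cE] := rot_to vc.
rewrite -!(next_rot i Uc) cE.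
move: c3 Uc; rewrite -(size_rot i) -(rot_uniq i) cE {cE}.
case: s => [|a [|b s]] //= _ /and3P[].
rewrite !inE eqxx !negb_or => /and3P[va vb _] _ _.
by rewrite ![_ == v]eq_sym (negPf va) eqxx vb.
Qed.

(** Connectedness of [S], witnessed by a spanning subtree; the witness is also the extra subtree
    behind the strict bound in [card_subtrees_at_leaf_gt]. *)
Definition spanned G S := exists2 p, is_subtree G p & p.1 = S.

(** A simple path from [u] to [w] in the spanning subtree avoids [v] and closes up through it. *)
Lemma two_neighbours_cycle G S v u w : symmetric G -> spanned G S ->
  v \notin S -> u \in S -> w \in S -> u != w -> G v u -> G v w ->
  exists c, [/\ cycle G c, uniq c, 2 < size c & v \in c].
Proof.
move=> symG [p pT pE] vS uS wS uw Gvu Gvw; subst S.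
case/and4P: pT => sg _ _ /forall_inP conn.
have /connectP[s0 ps0 wE0] := forall_inP (conn _ uS) _ wS.
case/shortenP: ps0 wE0 => s ps us _ wE {s0}.
have sS : {subset s <= p.1}.
  elim: s {us wE} u ps {uS uw Gvu} => //= z s IHs u /andP[uz zs] t.
  rewrite in_cons => /predU1P[->|]; last exact: IHs zs _.
  by case: (subgraph_adj symG sg uz).
exists (v :: u :: s); split.
- rewrite /= Gvu rcons_path -wE symG Gvw andbT.
  by apply: sub_path ps => a b /(subgraph_adj symG sg)[].
- rewrite cons_uniq us andbT inE negb_or; apply/andP; split.
    by apply: contraNneq vS => ->.
  by apply: contra vS; apply: sS.
- by case: s wE {ps us sS} => //= wE; rewrite wE eqxx in uw.
- exact: mem_head.
Qed.

(** Without such an edge [S] would be closed under adjacency and would contain [y]. *)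
Lemma exists_crossing_edge G S x y : symmetric G -> connect G x y ->
  x \in S -> y \notin S -> exists v, exists2 w, v \notin S /\ w \in S & G v w.
Proof.
move=> symG xy xS yS.
suff /existsP[v /existsP[w /and3P[]]] : [exists v, exists w, [&& v \notin S, w \in S & G v w]].
  by exists v, w.
apply: contraNT yS => noE.
rewrite -(closed_connect _ xy) //; apply: intro_closed; first exact: sym_connect_sym.
move=> a b ab aS; apply: contraNT noE => bS.
by apply/existsP; exists b; apply/existsP; exists a; rewrite bS aS symG.
Qed.

(* A path that can no longer be extended at its head closes up there: the head has
   a second neighbour, which must already lie on the path. *)
Lemma min_degree2_cycle (e : rel 'I_n) S : symmetric e ->
  (forall x y, x \in S -> exists z, [/\ z \in S, z != y & e x z]) ->
  irreflexive e -> S != set0 ->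
  exists c, [/\ cycle e c, uniq c & 2 < size c].
Proof.
move=> symE deg2 irrE /set0Pn[x0 x0S].
have [x1 [x1S _ e01]] := deg2 x0 x0 x0S.
(* Here [k] bounds the extensions still possible: at [k = 0] the path would have [n + 2] distinct
   vertices. *)
have long k : forall x y s, k + size s = n -> x \in S ->
    path e x (y :: s) -> uniq [:: x, y & s] ->
    exists c, [/\ cycle e c, uniq c & 2 < size c].
  elim: k => [|k IHk] x y s.
    move=> sn _ _ /card_uniqP /= us.
    by have := max_card [in [:: x, y & s]]; rewrite us card_ord; lia.
  move=> sn xS pxs us; have [z [zS zy xz]] := deg2 x y xS.
  have zx : z != x by apply: contraTneq xz => ->; rewrite irrE.
  have [zs|zs] := boolP (z \in s); last first.
    apply: (IHk z x (y :: s)) => //=; first by rewrite addnS -addSn.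
      by move: pxs => /= ->; rewrite symE xz.
    by move: us => /= ->; rewrite !inE !negb_or zx zy zs.
  (* The path is cut at [z]. As [z] lies beyond [y], the cycle has at least three vertices. *)
  case/splitPr: zs pxs us {sn} => s1 s2 pxs us.
  exists [:: x, y & rcons s1 z]; split; last by rewrite /= size_rcons.
    move: pxs; rewrite /= -cat_rcons cat_path => /and3P[-> ps _] /=.
    by rewrite rcons_path ps last_rcons symE.
  by move: us; rewrite -cat_rcons -!cat_cons cat_uniq => /andP[].
apply: (long n x0 x1 [::]) => //=; rewrite ?addn0 ?e01 //.
by rewrite inE andbT; apply: contraTneq e01 => ->; rewrite irrE.
Qed.

(** Degree two gives each vertex a neighbour other than any prescribed one, so [min_degree2_cycle]
    applies to the edges of [p]. That the list exhausts [p] is not claimed; uniqueness of the cycle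
    yields it later. *)
Lemma is_cycle_list G p : symmetric G -> irreflexive G -> is_cycle G p ->
  exists c, [/\ cycle G c, uniq c & 2 < size c].
Proof.
move=> symG irrG /and4P[sg p3 /forall_inP deg2 _].
have adjG := subgraph_adj symG sg.
have [||||c [cc Uc c3]] := @min_degree2_cycle (adjF p.2) p.1.
- exact: adjF_sym.
- move=> x y xp.
  have /existsP[e /and3P[eF xe ey]] :
      [exists e, [&& e \in p.2, x \in e & e != [set x; y]]].
    apply: contraTT (deg2 x xp) => /existsPn noE.
    suff : degF p.2 x <= 1 by case: (degF _ _) => [|[]].
    rewrite -(cards1 [set x; y]); apply/subset_leq_card/subsetP => e.
    rewrite !inE => /andP[eF xe]; apply: contraNT (noE e) => exy.
    by rewrite eF xe.
  case/andP: (sg) => /subsetP FG _.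
  have [a [b Gab eE]] := edgesE (FG _ eF); subst e.
  have [z zE] : exists z, [set a; b] = [set x; z].
    move: xe; rewrite !inE => /orP[]/eqP->; [by exists b | by exists a; rewrite setUC].
  rewrite zE in eF ey; exists z; split=> //; first by case: (adjG x z eF).
  by apply: contraNneq ey => ->.
- by move=> x; apply/negP => /adjG[]; rewrite irrG.
- by rewrite -card_gt0; apply: leq_trans p3.
by exists c; split=> //; apply: sub_cycle cc => a b /adjG[].
Qed.

End Cycles.

(** * The two extremal graphs, grown in the order of their labels *)

Section Extremal.
Variables (n l : nat).
Implicit Types (G H : rel 'I_n) (v w x y : 'I_n).

Definition initial m : {set 'I_n} := [set x : 'I_n | x < m].

Lemma initialS m v : v = m :> nat -> initial m.+1 = v |: initial m.
Proof. by move=> vm; apply/setP => x; rewrite !inE -val_eqE /= vm ltnS leq_eqVlt. Qed.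

Lemma initialT : initial n = setT.
Proof. by apply/setP => x; rewrite !inE ltn_ord. Qed.

(** Filtering [enum] keeps the labels increasing, which is the cyclic order in both [UP] and
    [US]. *)
Definition initial_cycle : seq 'I_n := [seq x : 'I_n <- enum 'I_n | x < l].

Lemma mem_initial_cycle x : (x \in initial_cycle) = (x < l).
Proof. by rewrite mem_filter mem_enum andbT. Qed.

Lemma initialE : initial l = [set x in initial_cycle].
Proof. by apply/setP => x; rewrite !inE mem_initial_cycle. Qed.

Lemma UP_sym : symmetric (UP n l).
Proof. by move=> x y; rewrite /UP /symr orbC. Qed.

Lemma US_sym : symmetric (US n l).
Proof. by move=> x y; rewrite /US /symr orbC. Qed.

Hypothesis l3 : 2 < l.

Lemma UP_irr : irreflexive (UP n l).
Proof. by move=> x; rewrite /UP /symr /=; lia. Qed.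

Lemma US_irr : irreflexive (US n l).
Proof. by move=> x; rewrite /US /symr /=; lia. Qed.

(** From label [l] on, the closing edge between 0 and [l.-1] no longer interferes, and [m.-1] is the
    only smaller neighbour of [m]. *)
Lemma UP_pendent m v w : l <= m -> v = m :> nat -> w = m.-1 :> nat ->
  pendent (UP n l) (initial m) v w.
Proof.
move=> lm vm wm; split; rewrite ?inE /UP /symr /=; try lia.
by move=> x; rewrite inE => xm Gvx; apply: val_inj => /=; lia.
Qed.

Lemma US_pendent m v w : l <= m -> v = m :> nat -> w = 0 :> nat ->
  pendent (US n l) (initial m) v w.
Proof.
move=> lm vm wm; split; rewrite ?inE /US /symr /=; try lia.
by move=> x; rewrite inE => xm Gvx; apply: val_inj => /=; lia.
Qed.

Hypothesis ln : l <= n.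

Lemma val_initial_cycle : map val initial_cycle = iota 0 l.
Proof.
rewrite -(filter_map val (fun i => i < l)) val_enum_ord.
exact: (filter_iota_ltn 0 ln).
Qed.

Lemma size_initial_cycle : size initial_cycle = l.
Proof. by rewrite -(size_map val) val_initial_cycle size_iota. Qed.

Lemma val_next_initial_cycle x : x < l ->
  val (next initial_cycle x) = if x.+1 < l then x.+1 else 0.
Proof.
move=> xl; have Ud : uniq initial_cycle by rewrite filter_uniq ?enum_uniq.
have <- := next_map val_inj Ud x; rewrite val_initial_cycle.
have xi : val x \in iota 0 l by rewrite mem_iota.
have ix : index (val x) (iota 0 l) = x.
  by rewrite -{1}[val x](nth_iota 0 0 xl) ?index_uniq ?size_iota ?iota_uniq.
rewrite (next_index 0 xi) size_iota ix; case: ifP => xl'; rewrite nth_iota //.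
exact: leq_ltn_trans xl.
Qed.

Lemma initial_cycle_induced H :
  (forall x y, x < l -> y < l -> H x y =
     [|| y == x.+1 :> nat, (x == 0 :> nat) && (y == l.-1 :> nat),
         x == y.+1 :> nat | (y == 0 :> nat) && (x == l.-1 :> nat)]) ->
  induced_cycle H initial_cycle.
Proof.
move=> HE; split=> [|x y]; first by rewrite filter_uniq ?enum_uniq.
rewrite !mem_initial_cycle => xl yl; rewrite HE // -!val_eqE /=.
have /= -> := val_next_initial_cycle xl; have /= -> := val_next_initial_cycle yl.
by case: ifP => ?; case: ifP => ?; lia.
Qed.

Lemma UP_cycle : induced_cycle (UP n l) initial_cycle.
Proof. by apply: initial_cycle_induced => x y xl yl; rewrite /UP /symr /=; lia. Qed.

Lemma US_cycle : induced_cycle (US n l) initial_cycle.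
Proof. by apply: initial_cycle_induced => x y xl yl; rewrite /US /symr /=; lia. Qed.

(** All induced cycles of length [l] have equal counts, at whichever vertex they are taken; the
    common value at a vertex is the constant [a] used below. *)
Lemma initial_cycle_counts G c x : symmetric G -> induced_cycle G c ->
  size c = l -> x \in c ->
  [/\ #|subtrees_in (UP n l) (initial l)| = #|subtrees_in G [set z in c]|,
      #|subtrees_in (US n l) (initial l)| = #|subtrees_in G [set z in c]|,
      forall y, y < l -> #|subtrees_at (UP n l) (initial l) y| =
                         #|subtrees_at G [set z in c] x| &
      forall y, y < l -> #|subtrees_at (US n l) (initial l) y| =
                         #|subtrees_at G [set z in c] x|].
Proof.
move=> symG Gc cl xc; have n0 : 0 < n by lia.
have sz : size initial_cycle = size c by rewrite size_initial_cycle.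
have UPc y : y < l -> _ := fun yl => induced_cycle_eq symG UP_sym UP_cycle Gc sz
  (etrans (mem_initial_cycle y) yl) xc.
have USc y : y < l -> _ := fun yl => induced_cycle_eq symG US_sym US_cycle Gc sz
  (etrans (mem_initial_cycle y) yl) xc.
have l0 : Ordinal n0 < l by move=> /=; lia.
rewrite initialE; split.
- by case: (UPc _ l0).
- by case: (USc _ l0).
- by move=> y /UPc[].
- by move=> y /USc[].
Qed.

(** Each new vertex is the support of the next one, and its count exceeds that of its own support by
    one. *)
Lemma UP_count a k w : w = (l + k).-1 :> nat ->
  (forall y, y < l -> #|subtrees_at (UP n l) (initial l) y| = a) ->
  #|subtrees_at (UP n l) (initial (l + k)) w| = a + k.
Proof.
move=> + base; elim: k w => [|k IHk] w wE; first by rewrite !addn0 base //; lia.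
have kn : (l + k).-1 < n by have := ltn_ord w; lia.
have pw : pendent (UP n l) (initial (l + k)) w (Ordinal kn).
  by apply: UP_pendent => //=; lia.
rewrite addnS (@initialS _ w) ?(card_subtrees_at_leaf UP_sym UP_irr pw); last lia.
by rewrite IHk // addnS.
Qed.

(** The support is always 0, where every new leaf doubles the count. *)
Lemma US_count a k w : l + k <= n -> w = 0 :> nat ->
  (forall y, y < l -> #|subtrees_at (US n l) (initial l) y| = a) ->
  #|subtrees_at (US n l) (initial (l + k)) w| = a * 2 ^ k.
Proof.
move=> + w0 base; elim: k => [|k IHk] kn; first by rewrite addn0 muln1 base //; lia.
have kn' : l + k < n by lia.
have pw : pendent (US n l) (initial (l + k)) (Ordinal kn') w.
  by apply: US_pendent => //=; lia.
rewrite addnS (@initialS _ (Ordinal kn')) // (card_subtrees_at_support US_sym US_irr pw).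
by rewrite (IHk (ltnW kn')) expnS mulnCA mul2n.
Qed.

End Extremal.

(** * Growing a unicyclic graph from its cycle, alongside [UP] and [US] *)

Section Unicyclic.
Variables (n l : nat) (G : rel 'I_n).
Hypotheses (ln : l <= n) (l3 : 2 < l) (simpleG : simple_graph G).
Hypothesis uniG : unicyclic_girth G l.

Let symG : symmetric G := proj1 simpleG.
Let irrG : irreflexive G := proj2 simpleG.

(** Every cycle list spans the unique cycle subgraph, which fixes its length and vertices. A chord
    would cut off a shorter cycle, so the cycle is induced. *)
Lemma unicyclic_cycle : exists c, [/\ cycle G c, induced_cycle G c, size c = l &
  forall d, cycle G d -> uniq d -> 2 < size d -> size d = l /\ d =i c].
Proof.
have [_ /eqP/cards1P[p0 p0E] girth] := uniG.
have p0c : is_cycle G p0 by have := set11 p0; rewrite -p0E inE.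
have [c [Gc Uc c3]] := is_cycle_list symG irrG p0c.
have cyc d : cycle G d -> uniq d -> 2 < size d -> size d = l /\ [set z in d] = p0.1.
  move=> Gd Ud d3; have dc := cycle_is_cycle symG irrG Ud d3 Gd.
  split; first by rewrite -(girth _ dc) /= cardsE (card_uniqP Ud).
  by have : _ \in [set p | is_cycle G p] := etrans (in_set _ _) dc; rewrite p0E => /set1P <-.
have [cl cE] := cyc _ Gc Uc c3.
exists c; split=> //; last first.
  move=> d Gd Ud d3; have [dl dE] := cyc d Gd Ud d3; split=> // z.
  by have /setP/(_ z) := etrans dE (esym cE); rewrite !inE.
split=> // x y xc yc; apply/idP/orP => [Gxy|]; last first.
  by case=> /eqP->; [|rewrite symG]; apply: next_cycle.
have [i s rE] := rot_to xc.
rewrite -!(next_rot i Uc) rE.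
move: Gc Uc cl yc; rewrite -(rot_cycle i) -(rot_uniq i) -(size_rot i) -(mem_rot i) rE.
move=> Gs Us sl; rewrite in_cons => /predU1P[yx|ys].
  by rewrite yx irrG in Gxy.
have yx : y != x by apply: contraTneq Gxy => ->; rewrite irrG.
case/splitPr: ys Gs Us sl {rE} => s1 s2.
case: s1 => [|a s1]; first by left; rewrite /= eqxx.
case: s2 => [|b s2] Gs Us sl.
  (* Here [y] comes last, so its successor is the head [x], which [next_nth] returns as the default
     value of [nth]. *)
  have ys : y \notin a :: s1.
    by move: Us; rewrite cons_uniq cat_uniq => /and4P[_ _ + _]; rewrite has_seq1.
  right; rewrite next_nth in_cons mem_cat mem_head !orbT -cat_cons index_cat.
  by rewrite in_cons (negPf yx) (negPf ys) /= eqxx addn0 nth_default ?size_cat ?addn1.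
(* The chord from [x] to [y] closes the arc through [a]; this cycle misses [b] and is shorter than
   [l]. *)
have [||| dl _] := cyc (x :: rcons (a :: s1) y).
- move: Gs; rewrite /= -cat_rcons rcons_cat cat_path => /and3P[-> ps _].
  by rewrite rcons_path ps last_rcons symG.
- by move: Us; rewrite -cat_rcons -cat_cons cat_uniq => /andP[].
- by rewrite /= size_rcons.
by move: sl; rewrite -dl /= size_cat size_rcons /=; lia.
Qed.

(** Connectedness supplies an edge leaving [S]. A second neighbour in [S] would put [v] on a cycle,
    but all cycles lie inside [S]. *)
Lemma unicyclic_growth (c : seq 'I_n) (S : {set 'I_n}) : spanned G S -> S != setT ->
  (forall d, cycle G d -> uniq d -> 2 < size d -> d =i c) ->
  {subset c <= S} -> S != set0 -> exists v w, pendent G S v w.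
Proof.
move=> spS ST cycG cS /set0Pn[x xS]; have [connG _ _] := uniG.
have /subsetPn[y _ yS] : ~~ (setT \subset S) by rewrite subTset.
have [v [w [vS wS] Gvw]] := exists_crossing_edge symG (connG x y) xS yS.
exists v, w; split=> // u uS Gvu; have [//|uw] := eqVneq u w.
have [d [Gd Ud d3 vd]] := two_neighbours_cycle symG spS vS uS wS uw Gvu Gvw.
by move: vS; rewrite cS // -(cycG d).
Qed.

(** The bounds on N_u(S) are kept for every [u] in [S], since any of them may support the next
    vertex. The clauses on [UP] and [US] tie [a] to the same cycle count at every stage. *)
Lemma unicyclic_exhaustion k : l + k <= n -> exists S,
  [/\ spanned G S, #|S| = l + k,
      exists2 c : seq 'I_n, {subset c <= S} &
        forall d, cycle G d -> uniq d -> 2 < size d -> d =i c,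
      exists a, [/\ forall y : 'I_n, y < l -> #|subtrees_at (UP n l) (initial n l) y| = a,
        forall y : 'I_n, y < l -> #|subtrees_at (US n l) (initial n l) y| = a &
        forall u, u \in S -> a + k <= #|subtrees_at G S u| <= a * 2 ^ k] &
      #|subtrees_in (UP n l) (initial n (l + k))| <= #|subtrees_in G S|
        <= #|subtrees_in (US n l) (initial n (l + k))|].
Proof.
elim: k => [|k IHk] kn.
  have [c [Gc ic cl cycG]] := unicyclic_cycle.
  have [x xc] : exists x, x \in c.
    by case: c cl {Gc ic cycG} => [|x c] /= cl; [lia | exists x; rewrite mem_head].
  have [UPt USt UPa USa] := initial_cycle_counts l3 ln symG ic cl xc.
  exists [set z in c]; rewrite !addn0; split.
  (* The cycle without its closing edge is a spanning path. *)
  - case: (c) Gc (proj1 ic) xc => // y s /=; rewrite rcons_path => /andP[ps _] Us _.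
    exact: path_spanned.
  - by rewrite cardsE (card_uniqP (proj1 ic)).
  - exists c => [z|d Gd Ud d3]; first by rewrite inE.
    by case: (cycG d Gd Ud d3).
  - exists #|subtrees_at G [set z in c] x|; split=> // u; rewrite inE => uc.
    have [_ _ UPu _] := initial_cycle_counts l3 ln symG ic cl uc.
    have n0 : 0 < n by lia.
    have o0 : Ordinal n0 < l by move=> /=; lia.
    by rewrite addn0 muln1 -(UPu _ o0) (UPa _ o0) leqnn.
  - by rewrite UPt USt leqnn.
have [|S [spS Sk [c cS cycG] [a [UPa USa aG]] /andP[lo hi]]] := IHk; first lia.
have S0 : S != set0 by rewrite -card_gt0 Sk; lia.
have ST : S != setT by apply: contraTneq kn => E; move: Sk; rewrite E cardsT card_ord; lia.
have [v [w vw]] := unicyclic_growth spS ST cycG cS S0.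
have [vS wS Gvw _] := vw.
have kn' : l + k < n by lia.
have kp : (l + k).-1 < n by lia.
have n0 : 0 < n by lia.
have pP : pendent (UP n l) (initial n (l + k)) (Ordinal kn') (Ordinal kp).
  by apply: UP_pendent => //=; lia.
have pS : pendent (US n l) (initial n (l + k)) (Ordinal kn') (Ordinal n0).
  by apply: US_pendent => //=; lia.
have /andP[aw1 aw2] := aG w wS.
exists (v |: S); split.
- case: spS => p pT pE; exists (add_leaf v w p); last by rewrite /= pE.
  by apply: add_leaf_subtree; rewrite ?pE.
- by rewrite cardsU1 vS Sk addnS.
- by exists c => // z /cS zS; rewrite setU1r.
- exists a; split=> // u; rewrite in_setU1 => /predU1P[->|uS].
    rewrite (card_subtrees_at_leaf symG irrG vw) addnS ltnS aw1 /=.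
    (* Positivity gives a * 2 ^ k >= 1, so that 1 + N_w(S) <= 1 + a * 2 ^ k <= a * 2 ^ k.+1. *)
    have a0 : 0 < #|subtrees_at G S w|.
      by case: spS => p pT pE; apply/card_gt0P; exists p; rewrite !inE pT pE subxx.
    by rewrite expnS; move: aw2 a0; set N := #|_|; set b := 2 ^ k; nia.
  have /andP[u1 u2] := aG u uS; case: spS => p pT pE.
  have lt := card_subtrees_at_leaf_gt symG irrG vw uS pT pE.
  have le := card_subtrees_at_leaf_le symG irrG vw uS.
  rewrite addnS (leq_ltn_trans u1 lt) /= (leq_trans le) // expnS mulnCA mul2n.
  by rewrite leq_double.
- rewrite addnS (@initialS _ _ (Ordinal kn')) //.
  rewrite [X in _ <= X <= _](card_subtrees_leaf symG irrG vw).
  rewrite [X in X <= _ <= _](card_subtrees_leaf (@UP_sym n l) (UP_irr l3) pP).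
  rewrite [X in _ <= _ <= X](card_subtrees_leaf (@US_sym n l) (US_irr l3) pS).
  (* The three totals grow by one more than a + k, N_w(S) and a * 2 ^ k respectively, which are in
     this order. *)
  rewrite (UP_count l3 ln (a := a)) // (US_count l3 ln (a := a)) //; last exact: ltnW.
  by rewrite !leq_add.
Qed.

End Unicyclic.

Theorem theorem2 (n l : nat) (G : rel 'I_n) :
  3 <= l -> l <= n -> simple_graph G -> unicyclic_girth G l ->
  nsubtrees (UP n l) <= nsubtrees G <= nsubtrees (US n l).
Proof.
move=> l3 ln sG uG; rewrite !nsubtreesE !ltnS.
(* After [n - l] additions [S] has [n] elements, hence is the whole vertex set. *)
have [|S [_ Sn _ _]] := unicyclic_exhaustion ln l3 sG uG (k := n - l).
  by rewrite subnKC.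
rewrite subnKC // initialT; suff -> : S = setT by [].
by apply/eqP; rewrite eqEcard subsetT cardsT card_ord Sn subnKC /=.
Qed.
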